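(* Let $X$ be a non-empty compact metric space, let $f:X\to X$ be a continuous function, and let $\Gamma(f)=\{(x,y)\in X\times X : y=f(x)\}$ be its graph. The following statements are equivalent. (1) $(X,f)$ is minimal. (2) $(X,\Gamma(f))$ is $1$-minimal. (3) $(X,\Gamma(f))$ is $1^{\oplus}$-minimal. (4) $(X,\Gamma(f))$ is $2^{\oplus}$-minimal. (5) $(X,\Gamma(f))$ is $3^{\oplus}$-minimal. (6) $(X,\Gamma(f))$ is $\infty$-minimal.
   Context: $(X,f)$ is minimal if every closed $A\subseteq X$ with $f(A)\subseteq A$ satisfies $A\in\{\emptyset,X\}$. A CR-dynamical system is a pair $(X,G)$ where $X$ is a compact metric space and $G\subseteq X\times X$ is a non-empty closed subset. Let $p_1(x,y)=x$ be the first projection $X\times X\to X$. Invariance: $A\subseteq X$ is $1$-invariant in $(X,G)$ if for each $x\in A$ with $x\in p_1(G)$ there is $y\in A$ such that $(x,y)\in G$; $A$ is $\infty$-invariant in $(X,G)$ if for each $(x,y)\in G$, $x\in A$ implies $y\in A$. For $k\in\{1,\infty\}$, $(X,G)$ is $k$-minimal if every closed subset $A$ of $X$ that is $k$-invariant in $(X,G)$ satisfies $A\in\{\emptyset,X\}$. Forward orbits: $\star_{i=1}^{\infty}G=\{(x_1,x_2,x_3,\ldots)\in\prod_{i=1}^\infty X : (x_i,x_{i+1})\in G \text{ for each positive integer } i\}$, and $\pi_k$ denotes the $k$-th coordinate projection. For $x\in X$, $T_G^{+}(x)=\{\mathbf x\in\star_{i=1}^{\infty}G : \pi_1(\mathbf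 x)=x\}$. For $\mathbf x\in\star_{i=1}^{\infty}G$, $\mathcal O_G^{\oplus}(\mathbf x)=\{\pi_k(\mathbf x): k\ge 1\}\subseteq X$. For $x\in X$, $\mathcal U_G^{\oplus}(x)=\bigcup_{\mathbf x\in T_G^{+}(x)}\mathcal O_G^{\oplus}(\mathbf x)$. $\mathrm{Cl}$ denotes closure in $X$. $(X,G)$ is $1^{\oplus}$-minimal if $T_G^{+}(x)\ne\emptyset$ for each $x\in X$ and $\mathrm{Cl}(\mathcal O_G^{\oplus}(\mathbf x))=X$ for each $\mathbf x\in\star_{i=1}^{\infty}G$; it is $2^{\oplus}$-minimal if for each $x\in X$ there is $\mathbf x\in T_G^{+}(x)$ with $\mathrm{Cl}(\mathcal O_G^{\oplus}(\mathbf x))=X$; it is $3^{\oplus}$-minimal if $\mathrm{Cl}(\mathcal U_G^{\oplus}(x))=X$ for each $x\in X$. *)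

(* Defs.v *)
From mathcomp Require Import all_boot all_order all_algebra.
From mathcomp Require Import all_classical all_reals topology.

Set Implicit Arguments.
Unset Strict Implicit.
Unset Printing Implicit Defensive.

Local Open Scope classical_set_scope.

Section CRDynamicalSystems.
Context {R : realType} {X : metricType R}.
Implicit Types (f : X -> X) (G : set (X * X)) (A : set X) (x : X).

Definition minimal f : Prop :=
  forall A, closed A -> f @` A `<=` A -> A = set0 \/ A = [set: X].

(* The notions below are defined for an arbitrary relation [G]; they are only
   meant for [G] with [CR_dynamical_system G]. *)
Definition CR_dynamical_system G : Prop :=
  [/\ compact [set: X], G !=set0 & closed G].

Definition graph f : set (X * X) := [set p | p.2 = f p.1].

Definition one_invariant G A : Prop :=
  forall x, A x -> (fst @` G) x -> exists2 y, A y & G (x, y).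

Definition infty_invariant G A : Prop :=
  forall x y, G (x, y) -> A x -> A y.

Definition one_minimal G : Prop :=
  forall A, closed A -> one_invariant G A -> A = set0 \/ A = [set: X].

Definition infty_minimal G : Prop :=
  forall A, closed A -> infty_invariant G A -> A = set0 \/ A = [set: X].

(* The infinite Mahavier product of [G]. Sequences are indexed from 0, so the
   k-th coordinate [pi_k] is the value at [k.-1]. *)
Definition star G : set (nat -> X) :=
  [set s | forall i, G (s i, s i.+1)].

Definition forward_trajectories G x : set (nat -> X) :=
  [set s | star G s /\ s 0 = x].

Definition forward_orbit (s : nat -> X) : set X := range s.

Definition forward_orbits_union G x : set X :=
  \bigcup_(s in forward_trajectories G x) forward_orbit s.

Definition one_oplus_minimal G : Prop :=
  (forall x, forward_trajectories G x !=set0) /\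
  (forall s, star G s -> closure (forward_orbit s) = [set: X]).

Definition two_oplus_minimal G : Prop :=
  forall x, exists2 s, forward_trajectories G x s &
    closure (forward_orbit s) = [set: X].

Definition three_oplus_minimal G : Prop :=
  forall x, closure (forward_orbits_union G x) = [set: X].

Lemma graph_CR_dynamical_system f :
  [set: X] !=set0 -> compact [set: X] -> continuous f ->
  CR_dynamical_system (graph f).
Proof.
move=> [x0 _] cX cf; split => //; first by exists (x0, f x0).
move=> [x y] clxy /=; apply: (@metric_hausdorff _ X) => U V Uy Vfx.
have fV : nbhs x (f @^-1` V) by exact: cf.
have [|[a b] /= [Gab]] := clxy ((f @^-1` V) `*` U).
  by exists (f @^-1` V, U).
by rewrite /graph /= in Gab; move=> [/= Vfa Ub]; exists b; split=> //; rewrite Gab.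
Qed.

End CRDynamicalSystems.

(* Main.v *)
Require Import Defs.
From mathcomp Require Import all_boot all_order all_algebra.
From mathcomp Require Import all_classical all_reals topology.

Local Open Scope classical_set_scope.

(** In a graph every point [x] has exactly one successor, [f x], so both kinds of invariance amount
    to [f] mapping the set into itself, and the trajectory from [x] is its sequence of iterates. Two
    facts drive the cycle of implications: by continuity the closure of an orbit is again invariant
    ([image_closure_sub]), so minimality makes orbits dense; conversely, a closed invariant set
    containing [x] contains every orbit from [x] ([forward_orbits_union_sub]), hence is all of the
    space once these orbits are jointly dense. *)

Lemma one_invariant_graph (R : realType) (X : metricType R) (f : X -> X)
  (A : set X) : one_invariant (graph f) A -> f @` A `<=` A.
Proof.
move=> invA _ [x Ax <-].
have [|y Ay] := invA x Ax; first by exists (x, f x).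
by rewrite /graph /= => <-.
Qed.

Lemma infty_invariant_graph (R : realType) (X : metricType R) (f : X -> X)
  (A : set X) : f @` A `<=` A -> infty_invariant (graph f) A.
Proof. by move=> fA x y; rewrite /graph /= => -> Ax; apply: fA; exists x. Qed.

Lemma infty_invariant_graph_one (R : realType) (X : metricType R) (f : X -> X)
  (A : set X) : infty_invariant (graph f) A -> one_invariant (graph f) A.
Proof. by move=> invA x Ax _; exists (f x) => //; apply: (invA x). Qed.

(** A neighbourhood of [f x] pulls back to a neighbourhood of [x], which meets [A]; the image of a
    common point lies in both [A] and the original neighbourhood. *)
Lemma image_closure_sub (T : topologicalType) (f : T -> T) (A : set T) :
  continuous f -> f @` A `<=` A -> f @` closure A `<=` closure A.
Proof.
move=> cf fA _ [x clx <-] V Vfx.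
have [y [Ay Vfy]] := clx _ (cf x V Vfx).
by exists (f y); split=> //; apply: fA; exists y.
Qed.

Lemma forward_trajectories_graph (R : realType) (X : metricType R)
  (f : X -> X) (x : X) : forward_trajectories (graph f) x !=set0.
Proof. by exists (fun n => iter n f x). Qed.

(** Induction along a trajectory: each step is an arrow of [G], which cannot leave [A]. *)
Lemma forward_orbits_union_sub (R : realType) (X : metricType R)
  (G : set (X * X)) (A : set X) (x : X) :
  infty_invariant G A -> A x -> forward_orbits_union G x `<=` A.
Proof.
move=> invA Ax _ [s [sG s0] [n _ <-]].
by elim: n => [|n IHn]; [rewrite s0 | apply: invA (sG n) IHn].
Qed.

Theorem theorem4p9 (R : realType) (X : metricType R)
  (X_nonempty : [set: X] !=set0) (X_compact : compact [set: X])
  (f : X -> X) (f_continuous : continuous f) :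
  [<-> minimal f;
       one_minimal (graph f);
       one_oplus_minimal (graph f);
       two_oplus_minimal (graph f);
       three_oplus_minimal (graph f);
       infty_minimal (graph f)].
Proof.
tfae.
- by move=> minf A clA /one_invariant_graph; apply: minf.
- move=> min1; split=> [x|s sG]; first exact: forward_trajectories_graph.
  (* Applying [f] shifts the trajectory: [s n.+1] is [f (s n)]. *)
  have sub : f @` forward_orbit s `<=` forward_orbit s.
    by move=> _ [_ [n _ <-] <-]; exists n.+1 => //; exact: sG.
  have invcl : one_invariant (graph f) (closure (forward_orbit s)).
    apply: infty_invariant_graph_one; apply: infty_invariant_graph.
    exact: (image_closure_sub _ _ _ f_continuous sub).
  have [cl0|//] := min1 _ (@closed_closure _ _) invcl.
  (* The empty alternative is excluded by the starting point of the orbit. *)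
  have : closure (forward_orbit s) (s 0) by apply: subset_closure; exists 0.
  by rewrite cl0.
- move=> [trajs dense] x; have [s sx] := trajs x.
  by exists s => //; apply: dense; case: sx.
- move=> min2 x; have [s sx dense] := min2 x.
  apply/seteqP; split=> // y _.
  have : closure (forward_orbit s) y by rewrite dense.
  by apply: closure_subset => z sz; exists s.
- move=> min3 A clA invA.
  have [->|/set0P [x Ax]] := eqVneq A set0; [by left | right].
  (* As [A] is closed, it suffices that [y] lies in its closure, which contains the dense union of
     orbits from [x]. *)
  apply/seteqP; split=> // y _; apply: clA.
  have : closure (forward_orbits_union (graph f) x) y by rewrite min3.
  by apply: closure_subset; exact: forward_orbits_union_sub.
- by move=> mini A clA /infty_invariant_graph; apply: mini.
Qed.
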